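(* Let $k\ge 1$ be an integer, let $\lambda\in\mathbb{C}$ with $\lambda\neq 0$, and let $$f_\lambda(x,y)=x^{2k}+\lambda\binom{2k}{k}x^ky^k+y^{2k}.$$ Then $L_{\mathbb{C}}(f_\lambda)=k$ if $\lambda=\pm1$, and $L_{\mathbb{C}}(f_\lambda)=k+1$ otherwise. Moreover, with $\zeta_k$ a primitive $k$-th root of unity and $\lambda^{1/k}$ a fixed $k$-th root of $\lambda$, the following is a minimal representation of $f_\lambda$ over $\mathbb{C}$, and it is the unique one when $\lambda=\pm1$ (in which case the first summand on the right vanishes): $$x^{2k}+\binom{2k}{k}\lambda x^ky^k+y^{2k}=(1-\lambda^2)\,y^{2k}+\frac1k\sum_{i=0}^{k-1}\bigl(x+\lambda^{1/k}\zeta_k^{\,i}\,y\bigr)^{2k}.$$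
   Context: For a field $K\subseteq\mathbb{C}$ and a binary form (homogeneous polynomial in $x,y$) $f\in K[x,y]$ of degree $d$, the $K$-rank $L_K(f)$ is the smallest $r$ for which there exist $\lambda_j,\alpha_j,\beta_j\in K$ with $f(x,y)=\sum_{j=1}^r\lambda_j(\alpha_jx+\beta_jy)^d$. A minimal representation of $f$ over $\mathbb{C}$ is such an expression with complex $\lambda_j,\alpha_j,\beta_j$ and exactly $r=L_{\mathbb{C}}(f)$ summands. Uniqueness is projective: up to reordering the summands and rescaling the linear forms $\alpha_jx+\beta_jy$ (with the compensating change of $\lambda_j$), i.e. the set of summands $\lambda_j(\alpha_jx+\beta_jy)^d$ is unique. *)

(* Defs.v *)
From mathcomp Require Export all_boot all_order all_algebra perm.
From mathcomp Require Export reals complex mpoly.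

Set Implicit Arguments.
Unset Strict Implicit.
Unset Printing Implicit Defensive.

Import GRing.Theory.
Local Open Scope ring_scope.

Section WaringRank.

(* The K-rank of f only involves f as an element of K[x,y], so the coefficient
   field is carried by the type: L_C is the instance F := C. *)
Variable F : fieldType.

Definition var_x : {mpoly F[2]} := 'X_ord0.
Definition var_y : {mpoly F[2]} := 'X_ord_max.

(* The data of lambda * (alpha x + beta y)^d; the exponent d is kept apart. *)
Record summand := Summand { coef : F; alpha : F; beta : F }.

Definition linear_form (t : summand) : {mpoly F[2]} :=
  alpha t *: var_x + beta t *: var_y.

Definition summand_poly (d : nat) (t : summand) : {mpoly F[2]} :=
  coef t *: linear_form t ^+ d.

Definition is_representation (d : nat) (f : {mpoly F[2]}) (r : nat)
    (T : 'I_r -> summand) : Prop :=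
  f = \sum_(j < r) summand_poly d (T j).

(* L_F(f) = r, for a binary form f of degree d. *)
Definition has_rank (d : nat) (f : {mpoly F[2]}) (r : nat) : Prop :=
  (exists T : 'I_r -> summand, is_representation d f T) /\
  (forall (s : nat) (T : 'I_s -> summand), is_representation d f T -> (r <= s)%N).

Definition is_minimal_representation (d : nat) (f : {mpoly F[2]}) (r : nat)
    (T : 'I_r -> summand) : Prop :=
  has_rank d f r /\ is_representation d f T.

(* The linear form is multiplied by c, and the coefficient divided by c ^+ d. *)
Definition rescaled (d : nat) (t u : summand) : Prop :=
  exists2 c : F, c != 0 &
    [/\ alpha u = c * alpha t, beta u = c * beta t & coef u * c ^+ d = coef t].

Definition same_representation (d r : nat) (S T : 'I_r -> summand) : Prop :=
  exists s : 'S_r, forall j : 'I_r, rescaled d (T j) (S (s j)).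

Definition is_unique_minimal_representation (d : nat) (f : {mpoly F[2]})
    (r : nat) (T : 'I_r -> summand) : Prop :=
  is_minimal_representation d f T /\
  (forall S : 'I_r -> summand,
     is_minimal_representation d f S -> same_representation d S T).

Definition form_f (k : nat) (lambda : F) : {mpoly F[2]} :=
  var_x ^+ (2 * k)
  + (lambda * 'C(2 * k, k)%:R) *: (var_x ^+ k * var_y ^+ k)
  + var_y ^+ (2 * k).

(* mu stands for lambda^(1/k).  Index 0 is (1 - lambda^2) y^(2k), and index
   i + 1 is (1/k) (x + mu zeta^i y)^(2k). *)
Definition term_f (k : nat) (lambda mu zeta : F) (n : nat) : summand :=
  if n is i.+1 then Summand (k%:R^-1) 1 (mu * zeta ^+ i)
  else Summand (1 - lambda ^+ 2) 0 1.

End WaringRank.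

(* Main.v *)
(** The moments of a representation [f = \sum_j c_j (a_j x + b_j y)^(2k)] are
    [\sum_j c_j a_j^(2k-t) b_j^t], which is [1], [lambda], [1] for
    [t = 0, k, 2k] and [0] for the other [t <= 2k].  A binary form [g] of degree
    [k] vanishing at all points [(a_j : b_j)] is orthogonal to the [k + 1]
    windows of [k + 1] consecutive moments (apolarity).  This forces
    [g = g_0 x^k + g_k y^k] with [g_0 + lambda g_k = lambda g_0 + g_k = 0].
    If [lambda^2 <> 1] then [g = 0], so there are more than [k] points.
    Otherwise [g] is a nonzero multiple of [y^k - lambda x^k].  With fewer than
    [k] points one could choose [g] to vanish at [(1 : 0)] as well, which is
    impossible; with exactly [k] points they are the [k] zeros of [g], on which
    the summands are linearly independent. *)

Require Import Defs.
From mathcomp Require Import cyclic separable cyclotomic.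
From mathcomp Require Import ring.

Set Implicit Arguments.
Unset Strict Implicit.
Unset Printing Implicit Defensive.

Import GRing.Theory Num.Theory.
Local Open Scope ring_scope.
Local Open Scope complex_scope.

(** * Moments of a representation *)

Lemma linear_form_expr (F : fieldType) (A : comAlgType F) (a b : F) (x y : A) d :
  (a *: x + b *: y) ^+ d =
  \sum_(j < d.+1) ('C(d, j)%:R * (a ^+ (d - j) * b ^+ j)) *: (x ^+ (d - j) * y ^+ j).
Proof.
rewrite exprDn; apply: eq_bigr => j _.
by rewrite !exprZn -scalerAl -scalerAr scalerA -scaler_nat scalerA.
Qed.

Section Dehomogenization.
Variable F : numFieldType.
Implicit Types (p : {mpoly F[2]}) (lambda : F) (t : summand F).

(** Setting x = 1 loses nothing on forms of fixed degree and makes their coefficients those of a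
    univariate polynomial. *)
Definition dehomogenize : {mpoly F[2]} -> {poly F} :=
  mmap (@polyC F) (fun i : 'I_2 => if i == ord0 then 1 else 'X).

Lemma dehomogenize_monomial i j :
  dehomogenize (var_x F ^+ i * var_y F ^+ j) = 'X^j.
Proof.
rewrite /dehomogenize rmorphM !rmorphXn /= !mmapX !mmap1U /=.
by rewrite expr1n mul1r.
Qed.

Lemma dehomogenize_summand d t :
  dehomogenize (summand_poly d t) =
  \poly_(j < d.+1) ('C(d, j)%:R * (coef t * alpha t ^+ (d - j) * beta t ^+ j)).
Proof.
rewrite /summand_poly /linear_form linear_form_expr poly_def.
rewrite /dehomogenize mmapZ raddf_sum mul_polyC scaler_sumr.
apply: eq_bigr => j _; rewrite /= mmapZ mul_polyC -/dehomogenize.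
by rewrite dehomogenize_monomial scalerA; congr (_ *: _); ring.
Qed.

Lemma dehomogenize_form_f k lambda :
  dehomogenize (form_f k lambda) =
  1 + (lambda * 'C(2 * k, k)%:R) *: 'X^k + 'X^(2 * k).
Proof.
have X0 n : var_x F ^+ n = var_x F ^+ n * var_y F ^+ 0 by rewrite expr0 mulr1.
have Y0 n : var_y F ^+ n = var_x F ^+ 0 * var_y F ^+ n by rewrite expr0 mul1r.
rewrite /form_f [X in X + _ + _]X0 [X in _ + X]Y0 /dehomogenize 2!rmorphD /=.
by rewrite mmapZ mul_polyC -/dehomogenize !dehomogenize_monomial expr0.
Qed.

(** Compare the coefficients of y^j: the factor ['C(2 * k, j)] occurs on both sides and is nonzero
    in characteristic 0. *)
Lemma form_f_moments k lambda r (T : 'I_r -> summand F) j :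
  is_representation (2 * k) (form_f k lambda) T -> (j <= 2 * k)%N ->
  \sum_i coef (T i) * alpha (T i) ^+ (2 * k - j) * beta (T i) ^+ j =
  (j == 0%N)%:R + lambda * (j == k)%:R + (j == 2 * k)%N%:R.
Proof.
move=> repT lej; have := congr1 (fun p => (dehomogenize p)`_j) repT.
have Cn0 : 'C(2 * k, j)%:R != 0 :> F by rewrite pnatr_eq0 -lt0n bin_gt0.
rewrite /= dehomogenize_form_f /dehomogenize raddf_sum coef_sum /=.
under eq_bigr => i _ do rewrite -/dehomogenize dehomogenize_summand coef_poly ltnS lej.
rewrite -mulr_sumr => Ej; apply: (mulfI Cn0); rewrite -{}Ej.
rewrite !coefD coef1 coefZ !coefXn !mulrDr; congr (_ + _ + _).
- by case: eqP => [->|]; rewrite ?bin0 ?mulr0 ?mulr1.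
- by case: eqP => [->|]; rewrite ?mulr0 ?mulr1 // mulrC.
- by case: eqP => [->|]; rewrite ?binn ?mulr0 ?mulr1.
Qed.

End Dehomogenization.

(** * Binary forms and products of linear factors *)

Section BinaryForms.
Variable F : fieldType.
Implicit Types (p : {poly F}) (a b : F) (l : F * F) (s : seq (F * F)).

(* The value at (a, b) of the binary form of degree n whose coefficients are
   those of p. *)
Definition homog_eval n p a b : F := \sum_(t < n.+1) p`_t * (a ^+ (n - t) * b ^+ t).

Lemma homog_eval_linear_mul n p c d a b : (size p <= n.+1)%N ->
  homog_eval n.+1 ((c%:P + d *: 'X) * p) a b = (c * a + d * b) * homog_eval n p a b.
Proof.
move=> szp; rewrite /homog_eval mulrDl -scalerAl mulrDl.
have E t : (c%:P * p + d *: ('X * p))`_t = c * p`_t + d * ('X * p)`_t.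
  by rewrite coefD coefCM coefZ.
under eq_bigr => t _ do rewrite E mulrDl.
rewrite big_split /=; congr (_ + _).
  (* The top term involves the coefficient of [p] of index [n.+1], which is 0 by the size bound. *)
  rewrite big_ord_recr /= nth_default // mulr0 mul0r addr0 mulr_sumr.
  by apply: eq_bigr => t _; rewrite subSn -1?ltnS // exprS; ring.
rewrite big_ord_recl coefXM eqxx mulr0 mul0r add0r mulr_sumr.
apply: eq_bigr => t _; rewrite coefXM /= /bump /= add1n /= subSS exprS; ring.
Qed.

(** The product of the forms c x + d y at x = 1. Its size drops when some d is 0, so the degree of
    the form is recorded by [size s]. *)
Definition linear_factors s : {poly F} := \prod_(l <- s) (l.1%:P + l.2 *: 'X).

Lemma size_linear_factor l : (size (l.1%:P + l.2 *: 'X)%R <= 2)%N.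
Proof.
rewrite (leq_trans (size_polyD _ _)) // geq_max (leq_trans (size_polyC_leq1 _)) //.
by rewrite (leq_trans (size_scale_leq _ _)) ?size_polyX.
Qed.

Lemma size_linear_factors s : (size (linear_factors s) <= (size s).+1)%N.
Proof.
rewrite /linear_factors; elim: s => [|l s IHs]; first by rewrite big_nil size_poly1.
rewrite big_cons (leq_trans (size_polyMleq _ _)) //=.
have := leq_add (size_linear_factor l) IHs.
by rewrite add2n; case: (_ + _)%N.
Qed.

Lemma homog_eval_linear_factors s a b :
  homog_eval (size s) (linear_factors s) a b = \prod_(l <- s) (l.1 * a + l.2 * b).
Proof.
elim: s => [|l s IHs].
  by rewrite /homog_eval /linear_factors !big_nil big_ord1 coef1 !mul1r.
rewrite /linear_factors !big_cons -/(linear_factors s).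
by rewrite homog_eval_linear_mul ?size_linear_factors // IHs.
Qed.

Lemma linear_factors_neq0 s : all (predC1 (0, 0)) s -> linear_factors s != 0.
Proof.
move=> /allP s0; rewrite /linear_factors prodf_seq_neq0; apply/allP => -[c d] /s0 /=.
apply: contra => /eqP /polyP E; have := E 0%N; have := E 1%N.
rewrite !coefD !coefC !coefZ !coefX /= !mulr0 !mulr1 !addr0 !add0r => -> ->.
by rewrite eqxx.
Qed.

End BinaryForms.

(** * Apolarity with the moments *)

Section Apolarity.
Variables (F : numFieldType) (k : nat) (lambda : F).
Hypotheses (k_gt0 : (0 < k)%N) (lambda_neq0 : lambda != 0).
Implicit Types p : {poly F}.

Lemma sum_coef_shift p n s m :
  \sum_(t < n.+1) p`_t * (t + s == m)%N%:R =
  if (s <= m <= n + s)%N then p`_(m - s) else 0.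
Proof.
have [/andP[lesm lemn]|out] := ifPn.
  have lt_n : (m - s < n.+1)%N by rewrite ltnS leq_subLR addnC.
  rewrite (bigD1 (Ordinal lt_n)) //= subnK // eqxx mulr1 big1 ?addr0 // => i.
  rewrite -val_eqE /= => /negPf ne_i.
  by rewrite -(subnK lesm) eqn_add2r ne_i mulr0.
rewrite big1 // => i _; case: eqP => [E|_]; last by rewrite mulr0.
by move: out; rewrite -E leq_addl leq_add2r -ltnS ltn_ord.
Qed.

Section Orthogonality.
Variables (r : nat) (T : 'I_r -> summand F) (p : {poly F}).
Hypothesis repT : is_representation (2 * k) (form_f k lambda) T.
Hypothesis p_vanishes : forall i, homog_eval k p (alpha (T i)) (beta (T i)) = 0.

(** After exchanging the sums, the contribution of summand i factors as its coefficient times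
    alpha^(k-s) beta^s times the value of the form at (alpha, beta), which is 0. *)
Lemma apolar_orthogonal s : (s <= k)%N ->
  \sum_(t < k.+1) p`_t * ((t + s == 0)%N%:R + lambda * (t + s == k)%N%:R
    + (t + s == 2 * k)%N%:R) = 0.
Proof.
move=> le_sk.
have bound (t : 'I_k.+1) : (t + s <= 2 * k)%N.
  by rewrite mul2n -addnn leq_add // -ltnS.
under eq_bigr => t _ do rewrite -(form_f_moments repT (bound t)) mulr_sumr.
rewrite exchange_big big1 //= => i _.
transitivity (coef (T i) * alpha (T i) ^+ (k - s) * beta (T i) ^+ s
    * homog_eval k p (alpha (T i)) (beta (T i))); last by rewrite p_vanishes mulr0.
rewrite mulr_sumr; apply: eq_bigr => t _.
have le_tk : (t <= k)%N by rewrite -ltnS.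
have -> : (2 * k - (t + s) = (k - s) + (k - t))%N.
  by rewrite mul2n -addnn subnDA -addnBA // addnC -addnBA // addnC.
by rewrite !exprD; ring.
Qed.

Lemma apolar_coefs :
  [/\ p`_0 = - lambda * p`_k, p`_k = - lambda * p`_0
    & forall t, (0 < t < k)%N -> p`_t = 0].
Proof.
(* The nonzero moments have indices 0, k, 2k. The window starting at s always meets k, meets 0 only
   for s = 0, and meets 2k only for s = k; an intermediate window thus isolates one coefficient. *)
have W s : (s <= k)%N ->
  (if (s <= 0)%N then p`_0 else 0) + lambda * p`_(k - s)
  + (if (k <= s)%N then p`_(2 * k - s) else 0) = 0.
  move=> le_sk; have := apolar_orthogonal le_sk.
  under eq_bigr => t _ do rewrite !mulrDr mulrCA.
  rewrite !big_split /= -mulr_sumr !sum_coef_shift /= andbT le_sk leq_addr.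
  rewrite mul2n -addnn leq_add2l (leq_trans le_sk (leq_addr _ _)) /=.
  by rewrite sub0n.
split.
- have := W 0%N (leq0n k); rewrite /= subn0 leqNgt k_gt0 addr0.
  by move/eqP; rewrite addr_eq0 -mulNr => /eqP.
- have := W k (leqnn k); rewrite subnn leqNgt k_gt0 /= leqnn add0r.
  by rewrite mul2n -addnn addnK addrC => /eqP; rewrite addr_eq0 -mulNr => /eqP.
move=> t /andP[t_gt0 lt_tk]; have := W (k - t)%N (leq_subr _ _).
have -> : (k - t <= 0)%N = false by rewrite leqNgt subn_gt0 lt_tk.
have -> : (k <= k - t)%N = false by rewrite leqNgt ltn_subrL t_gt0 k_gt0.
rewrite add0r addr0 subKn 1?ltnW // => /eqP.
by rewrite mulf_eq0 (negPf lambda_neq0) => /eqP.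
Qed.

Lemma apolar_homog_eval a b :
  homog_eval k p a b = p`_k * (b ^+ k - lambda * a ^+ k).
Proof.
have [p0 _ pt] := apolar_coefs.
rewrite /homog_eval -(big_mkord xpredT (fun t => p`_t * (a ^+ (k - t) * b ^+ t))).
rewrite big_nat_recr //= big_ltn // big_nat big1 => [|t /pt->]; last by rewrite mul0r.
by rewrite p0 subn0 subnn !expr0; ring.
Qed.

Lemma apolar_eq0 : (size p <= k.+1)%N -> p`_k = 0 -> p = 0.
Proof.
have [p0 _ pt] := apolar_coefs => szp pk; apply/polyP => t; rewrite coef0.
have [->|] := posnP t; first by rewrite p0 pk mulr0.
have [lt_tk t_gt0|lt_kt _|-> //] := ltngtP t k; first by rewrite pt ?t_gt0.
by rewrite nth_default // (leq_trans szp).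
Qed.

End Orthogonality.

(** * Forms annihilating at most k summands *)

Implicit Types t : summand F.

(* For the zero linear form, whose summand contributes nothing, the factor is x:
   it is nonzero and does not vanish at any point (1, b). *)
Definition annihilator t : F * F :=
  if (alpha t == 0) && (beta t == 0) then (1, 0) else (beta t, - alpha t).

Lemma annihilator_neq0 t : annihilator t != (0, 0).
Proof.
rewrite /annihilator; case: ifPn; rewrite xpair_eqE ?oner_eq0 //.
by rewrite oppr_eq0 andbC.
Qed.

Lemma annihilator_vanishes t :
  (annihilator t).1 * alpha t + (annihilator t).2 * beta t = 0.
Proof.
rewrite /annihilator; case: ifPn => [/andP[/eqP-> /eqP->]|_] /=; last ring.
by rewrite !mulr0 addr0.
Qed.

Lemma annihilator_root t b : (annihilator t).1 * 1 + (annihilator t).2 * b = 0 ->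
  alpha t != 0 /\ beta t = alpha t * b.
Proof.
rewrite /annihilator; case: ifPn => [_|nz] /=.
  by rewrite mulr1 mul0r addr0 => /eqP; rewrite oner_eq0.
rewrite mulr1 mulNr => /eqP; rewrite subr_eq0 => /eqP E; split=> //.
by apply: contra nz => a0; rewrite E (eqP a0) mul0r eqxx.
Qed.

(* Padding by the factor y, which vanishes at (1, 0), makes the degree equal to k. *)
Definition annihilators r (T : 'I_r -> summand F) : seq (F * F) :=
  codom (annihilator \o T) ++ nseq (k - r) (0, 1).

Section Annihilators.
Variables (r : nat) (T : 'I_r -> summand F).
Hypothesis le_rk : (r <= k)%N.
Hypothesis repT : is_representation (2 * k) (form_f k lambda) T.
Let p := linear_factors (annihilators T).

Lemma size_annihilators : size (annihilators T) = k.
Proof. by rewrite size_cat size_codom size_nseq card_ord subnKC. Qed.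

Lemma homog_eval_annihilators a b :
  homog_eval k p a b = \prod_(l <- annihilators T) (l.1 * a + l.2 * b).
Proof. by rewrite -homog_eval_linear_factors size_annihilators. Qed.

Lemma annihilators_vanish i : homog_eval k p (alpha (T i)) (beta (T i)) = 0.
Proof.
rewrite homog_eval_annihilators; apply/eqP; rewrite prodf_seq_eq0.
apply/hasP; exists (annihilator (T i)); last by rewrite /= annihilator_vanishes.
by rewrite mem_cat (codom_f (annihilator \o T)).
Qed.

(** By apolarity, a zero coefficient of index k would make the whole product vanish, yet each of its
    factors is nonzero. *)
Lemma annihilators_lead_neq0 : p`_k != 0.
Proof.
have : p != 0.
  apply: linear_factors_neq0; rewrite all_cat; apply/andP; split.
    by apply/allP => _ /codomP[i ->]; apply: annihilator_neq0.
  by apply/allP => _ /nseqP[-> _]; rewrite /= xpair_eqE oner_eq0 andbF.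
apply: contra => /eqP pk; apply/eqP; apply: (apolar_eq0 repT annihilators_vanish) pk.
by rewrite (leq_trans (size_linear_factors _)) ?size_annihilators.
Qed.

Lemma few_summands_lambda : lambda ^+ 2 = 1.
Proof.
have [p0 pk _] := apolar_coefs repT annihilators_vanish.
(* The two relations between the extreme coefficients combine to [p]_k = lambda ^+ 2 * p[_k]. *)
apply: (mulIf annihilators_lead_neq0); rewrite mul1r [RHS]pk p0; ring.
Qed.

Lemma few_summands_size : r = k.
Proof.
apply/eqP; rewrite eqn_leq le_rk leqNgt /=; apply/negP => lt_rk.
have := homog_eval_annihilators 1 0.
rewrite (apolar_homog_eval repT annihilators_vanish) expr1n expr0n (gtn_eqF k_gt0).
have -> : \prod_(l <- annihilators T) (l.1 * 1 + l.2 * 0) = 0.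
  apply/eqP; rewrite prodf_seq_eq0; apply/hasP; exists (0, 1).
    by rewrite mem_cat mem_nseq subn_gt0 lt_rk eqxx orbT.
  by rewrite /= mul0r mulr0 addr0.
by move/eqP; rewrite mulr1 sub0r mulf_eq0 oppr_eq0 (negPf annihilators_lead_neq0)
  (negPf lambda_neq0).
Qed.

(** The point (1, b) is a zero of the apolar form, hence of one factor; as r = k, there is no
    padding and this factor comes from a summand. *)
Lemma annihilators_root b : r = k -> b ^+ k = lambda ->
  exists i, alpha (T i) != 0 /\ beta (T i) = alpha (T i) * b.
Proof.
move=> rk bk; have := homog_eval_annihilators 1 b.
rewrite (apolar_homog_eval repT annihilators_vanish) expr1n bk mulr1 subrr mulr0.
move/esym/eqP; rewrite prodf_seq_eq0 => /hasP[l].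
rewrite /annihilators (_ : k - r = 0)%N ?rk ?subnn // cats0.
by move=> /codomP[i ->] /eqP/annihilator_root; exists i.
Qed.

End Annihilators.

End Apolarity.

(** * Power sums and roots of unity *)

Lemma power_sums_eq0 (F : idomainType) n (w b : 'I_n -> F) : injective b ->
  (forall t, (t < n)%N -> \sum_i w i * b i ^+ t = 0) -> forall i, w i = 0.
Proof.
(* A Lagrange-type test polynomial of degree n - 1, vanishing at every node except [b i0]; the
   hypotheses kill its weighted sum. *)
move=> injb w0 i0; pose q := \prod_(i <- enum (predC1 i0)) ('X - (b i)%:P).
have szq : size q = n.
  by rewrite size_prod_XsubC -cardE cardC1 card_ord prednK // (leq_ltn_trans _ (ltn_ord i0)).
have : \sum_i w i * q.[b i] = 0.
  under eq_bigr => i _ do rewrite horner_coef szq mulr_sumr.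
  rewrite exchange_big big1 //= => t _.
  under eq_bigr => i _ do rewrite mulrCA.
  by rewrite -mulr_sumr w0 ?mulr0.
rewrite (bigD1 i0) //= big1 => [|i ni].
  rewrite addr0 => /eqP; rewrite mulf_eq0 => /orP[/eqP //|].
  rewrite horner_prod prodf_seq_eq0 => /hasP[j]; rewrite mem_enum /=.
  by rewrite hornerXsubC subr_eq0 (inj_eq injb) inE eq_sym => /negPf->.
have i_enum : i \in enum (predC1 i0) by rewrite mem_enum.
by rewrite horner_prod (big_rem i) //= hornerXsubC subrr mul0r mulr0.
Qed.

Lemma prim_root_power_sum (F : fieldType) k (zeta mu : F) j :
  k.-primitive_root zeta ->
  \sum_(i < k) (mu * zeta ^+ i) ^+ j = if (k %| j)%N then k%:R * mu ^+ j else 0.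
Proof.
move=> prim; under eq_bigr => i _ do rewrite exprMn exprAC.
rewrite -mulr_sumr (prim_order_dvd prim); case: eqP => [->|/eqP zj].
  under eq_bigr => i _ do rewrite expr1n.
  by rewrite sumr_const card_ord mulrC.
apply/eqP; rewrite mulf_eq0; apply/orP; right.
(* Geometric series of ratio [zeta ^+ j], which differs from 1. *)
have := subrX1 (zeta ^+ j) k; rewrite exprAC (prim_expr_order prim) expr1n subrr.
by move/esym/eqP; rewrite mulf_eq0 subr_eq0 (negPf zj).
Qed.

(** X^n - 1 splits and is separable, as n is nonzero in the field; its n distinct roots include a
    primitive one. *)
Lemma closed_prim_root_exists (F : closedFieldType) n :
  n%:R != 0 :> F -> exists z : F, n.-primitive_root z.
Proof.
move=> nF_neq0; have n_gt0 : (0 < n)%N by case: n nF_neq0; rewrite ?eqxx.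
have [rs Drs] := closed_field_poly_normal ('X^n - 1 : {poly F}).
rewrite (monicP _) ?monicXnsubC // scale1r in Drs.
have rs1 : all n.-unity_root rs by apply/allP=> z; rewrite -root_prod_XsubC -Drs.
have sz_rs : (n < (size rs).+1)%N by rewrite -(size_prod_XsubC rs id) -Drs size_XnsubC.
have [|z] := hasP (has_prim_root n_gt0 rs1 _ sz_rs); last by exists z.
by rewrite -separable_prod_XsubC -Drs separable_Xn_sub_1.
Qed.

(** * The explicit representation and its uniqueness *)

Section Representations.
Variables (F : numFieldType) (k : nat) (lambda zeta mu : F).
Hypotheses (prim_zeta : k.-primitive_root zeta) (mu_k : mu ^+ k = lambda).

Let k_gt0 : (0 < k)%N := prim_order_gt0 prim_zeta.

(** Averaging over the k-th roots of unity keeps only the exponents j divisible by k, namely 0, k,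
    2k. The term j = 2k has coefficient mu^(2k) = lambda^2, which the first summand corrects to
    1. *)
Lemma form_f_decomposition :
  form_f k lambda =
  (1 - lambda ^+ 2) *: var_y F ^+ (2 * k)
  + k%:R^-1 *: \sum_(i < k)
      (var_x F + (mu * zeta ^+ i) *: var_y F) ^+ (2 * k).
Proof.
have kF_neq0 : k%:R != 0 :> F by rewrite pnatr_eq0 -lt0n.
have expand i : (var_x F + (mu * zeta ^+ i) *: var_y F) ^+ (2 * k) =
    \sum_(j < (2 * k).+1) ('C(2 * k, j)%:R * (mu * zeta ^+ i) ^+ j)
      *: (var_x F ^+ (2 * k - j) * var_y F ^+ j).
  rewrite -[X in X + _]scale1r linear_form_expr.
  by apply: eq_bigr => j _; rewrite expr1n mul1r.
under eq_bigr => i _ do rewrite expand.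
rewrite exchange_big scaler_sumr /=.
pose c j := if (k %| j)%N then 'C(2 * k, j)%:R * mu ^+ j else 0.
rewrite (eq_bigr (fun j : 'I__ => c j *: (var_x F ^+ (2 * k - j) * var_y F ^+ j)));
  last first.
  move=> j _; rewrite -scaler_suml -mulr_sumr scalerA prim_root_power_sum //.
  by rewrite /c; case: ifP; rewrite ?mulr0 // mulrCA mulKf.
have lt0 : (0 < (2 * k).+1)%N by [].
have ltk : (k < (2 * k).+1)%N by rewrite ltnS leq_pmull.
have lt2k : (2 * k < (2 * k).+1)%N by [].
rewrite (bigD1 (Ordinal lt0)) //= (bigD1 (Ordinal ltk)) /=; last first.
  by rewrite -val_eqE /= -lt0n.
rewrite (bigD1 (Ordinal lt2k)) /=; last first.
  by rewrite -!val_eqE /= muln_eq0 /= (gtn_eqF k_gt0) /= gtn_eqF // ltn_Pmull.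
rewrite big1 ?addr0 => [|j]; last first.
  rewrite -!val_eqE /= -andbA => /and3P[j0 jk j2k].
  rewrite /c; case: ifP; rewrite ?scale0r // => /dvdnP[q jq].
  have := ltn_ord j; rewrite jq ltnS leq_pmul2r //.
  by move: j0 jk j2k; rewrite jq; case: q {jq} => [|[|[|q]]] //; rewrite ?mul1n eqxx.
rewrite /c dvdn0 dvdnn dvdn_mull // bin0 binn expr0 mulr1 scale1r.
rewrite subn0 subnn expr0 mul1r mulr1 mul1r mu_k.
have -> : mu ^+ (2 * k) = lambda ^+ 2 by rewrite mulnC exprM mu_k.
have -> : (2 * k - k = k)%N by rewrite mul2n -addnn addnK.
rewrite /form_f scalerBl scale1r [_%:R * lambda]mulrC [RHS]addrC -!addrA.
by congr (_ + (_ + _)); rewrite addrC subrK.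
Qed.

Lemma term_f_summand_poly i : summand_poly (2 * k) (term_f k lambda mu zeta i.+1) =
  k%:R^-1 *: (var_x F + (mu * zeta ^+ i) *: var_y F) ^+ (2 * k).
Proof. by rewrite /summand_poly /linear_form /= scale1r. Qed.

Lemma term_f_representation :
  is_representation (2 * k) (form_f k lambda)
    (fun i : 'I_k.+1 => term_f k lambda mu zeta i).
Proof.
rewrite /is_representation form_f_decomposition big_ord_recl scaler_sumr; congr (_ + _).
  by rewrite /summand_poly /linear_form /= scale0r add0r scale1r.
by apply: eq_bigr => i _; rewrite term_f_summand_poly.
Qed.

Lemma term_f_short_representation : lambda ^+ 2 = 1 ->
  is_representation (2 * k) (form_f k lambda)
    (fun i : 'I_k => term_f k lambda mu zeta i.+1).
Proof.
move=> l2; rewrite /is_representation form_f_decomposition l2 subrr scale0r add0r.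
by rewrite scaler_sumr; apply: eq_bigr => i _; rewrite term_f_summand_poly.
Qed.

Lemma lambda_root_inj : lambda != 0 -> injective (fun i : 'I_k => mu * zeta ^+ i).
Proof.
move=> l0 i j /= E; have mu0 : mu != 0.
  by apply: contra l0 => /eqP m0; rewrite -mu_k m0 expr0n (gtn_eqF k_gt0).
apply/val_inj/eqP; move/(mulfI mu0)/eqP: E; rewrite (eq_prim_root_expr prim_zeta).
by rewrite !modn_small.
Qed.

Lemma short_representation_unique (S : 'I_k -> summand F) :
  lambda ^+ 2 = 1 -> is_representation (2 * k) (form_f k lambda) S ->
  same_representation (2 * k) S (fun i : 'I_k => term_f k lambda mu zeta i.+1).
Proof.
move=> l2 repS; pose b (i : 'I_k) := mu * zeta ^+ i.
have l0 : lambda != 0 by apply: contra_eqN l2 => /eqP->; rewrite expr0n eq_sym oner_eq0.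
have injb : injective b by apply: lambda_root_inj.
have bk i : b i ^+ k = lambda.
  by rewrite exprMn mu_k exprAC (prim_expr_order prim_zeta) expr1n mulr1.
(* Choose for each zero (1 : b j) a summand of [S] whose linear form has that direction. *)
have /fin_all_exists[s sP] j :=
  annihilators_root k_gt0 l0 (leqnn k) repS (erefl k) (bk j).
have injs : injective s.
  move=> i j sij; apply: injb; have [a0 Ei] := sP i; have [_ Ej] := sP j.
  by apply: (mulfI a0); rewrite -Ei sij Ej.
(* The defect of the i-th weight once the linear form is normalized to alpha = 1. Equality of the
   first k moments at k distinct nodes forces it to vanish. *)
pose w i := coef (S (s i)) * alpha (S (s i)) ^+ (2 * k) - k%:R^-1.
have w0 : forall i, w i = 0.
  apply: (power_sums_eq0 injb) => t lt_tk.
  have le_t : (t <= 2 * k)%N by rewrite (leq_trans (ltnW lt_tk)) ?leq_pmull.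
  under eq_bigr => i _ do rewrite mulrBl.
  rewrite sumrB; apply/eqP; rewrite subr_eq0; apply/eqP.
  transitivity (\sum_i coef (S i) * alpha (S i) ^+ (2 * k - t) * beta (S i) ^+ t).
    rewrite [RHS](reindex_inj injs); apply: eq_bigr => i _.
    move: (b i) (proj2 (sP i)) => bi ->.
    by rewrite exprMn mulrA -[in LHS](subnK le_t) exprD !mulrA.
  rewrite (form_f_moments repS le_t).
  rewrite -(form_f_moments (term_f_short_representation l2) le_t).
  by apply: eq_bigr => i _; rewrite /= expr1n mulr1.
exists (perm injs) => i; rewrite permE; have [a0 Ei] := sP i.
exists (alpha (S (s i))) => //=; split; rewrite ?mulr1 //.
by apply/eqP; rewrite -subr_eq0; apply/eqP/w0.
Qed.

End Representations.

(** * Lower bound and rank *)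

Lemma form_f_rank_ge (F : numFieldType) k (lambda : F) r (T : 'I_r -> summand F) :
  (0 < k)%N -> lambda != 0 -> is_representation (2 * k) (form_f k lambda) T ->
  if lambda ^+ 2 == 1 then (k <= r)%N else (k < r)%N.
Proof.
move=> k_gt0 l0 repT; have [le_rk|/[dup] lt_kr /ltnW] := leqP r k; last by case: ifP.
by rewrite (few_summands_lambda k_gt0 l0 le_rk repT) eqxx
  (few_summands_size k_gt0 l0 le_rk repT).
Qed.

Theorem theorem3p6 (R : realType) (k : nat) (lambda : R[i])
    (k_ge1 : (1 <= k)%N) (lambda_neq0 : lambda != 0) :
  [/\ (lambda = 1 \/ lambda = -1 -> has_rank (2 * k) (form_f k lambda) k),
      (~ (lambda = 1 \/ lambda = -1) ->
         has_rank (2 * k) (form_f k lambda) k.+1) &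
      forall zeta mu : R[i], k.-primitive_root zeta -> mu ^+ k = lambda ->
      [/\ form_f k lambda =
            (1 - lambda ^+ 2) *: var_y R[i] ^+ (2 * k)
            + k%:R^-1 *: \sum_(i < k)
                (var_x R[i] + (mu * zeta ^+ i) *: var_y R[i]) ^+ (2 * k),
          (~ (lambda = 1 \/ lambda = -1) ->
             is_minimal_representation (2 * k) (form_f k lambda)
               (fun i : 'I_k.+1 => term_f k lambda mu zeta i)) &
          (lambda = 1 \/ lambda = -1 ->
             (1 - lambda ^+ 2) *: var_y R[i] ^+ (2 * k) = 0 /\
             is_unique_minimal_representation (2 * k) (form_f k lambda)
               (fun i : 'I_k => term_f k lambda mu zeta i.+1))]].
Proof.
have sqr1 : lambda = 1 \/ lambda = -1 <-> lambda ^+ 2 = 1.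
  split=> [[] ->|/eqP]; rewrite ?sqrrN ?expr1n // sqrf_eq1.
  by case/orP => /eqP; [left|right].
have kC_neq0 : k%:R != 0 :> R[i] by rewrite pnatr_eq0 -lt0n.
(* The rank claims mention no roots, so some [z] and a k-th root of [lambda] are fixed to exhibit
   representations. *)
have [z prim_z] := closed_prim_root_exists kC_neq0.
have root_l : (k.-root lambda) ^+ k = lambda by rewrite rootCK.
have rank1 : lambda = 1 \/ lambda = -1 -> has_rank (2 * k) (form_f k lambda) k.
  move=> /sqr1 l2; split.
    by eexists; apply: (term_f_short_representation prim_z root_l l2).
  by move=> s T /(form_f_rank_ge k_ge1 lambda_neq0); rewrite l2 eqxx.
have rank2 : ~ (lambda = 1 \/ lambda = -1) ->
    has_rank (2 * k) (form_f k lambda) k.+1.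
  move=> nl; split; first by eexists; apply: (term_f_representation prim_z root_l).
  move=> s T /(form_f_rank_ge k_ge1 lambda_neq0); case: eqP => // l2.
  by case: nl; apply/sqr1.
split=> // zeta mu prim_zeta mu_k; split.
- exact: form_f_decomposition.
- by move=> nl; split; [apply: rank2|apply: term_f_representation].
move=> l1; have l2 : lambda ^+ 2 = 1 by apply/sqr1.
split; first by rewrite l2 subrr scale0r.
split; first by split; [apply: rank1|apply: term_f_short_representation].
by move=> S [_ repS]; apply: short_representation_unique.
Qed.
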